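(* Let $C=(C_\bullet,b,B)$ be a quasi-mixed complex of $k$-modules, let $\pi^T:C_\bullet\to C_\bullet$ be the projection onto $\ker(1-T)$ associated with the splitting $C_\bullet=\ker(1-T)\oplus\operatorname{ran}(1-T)$, and set $\tilde B=\pi^TB$. (1) $\tilde C:=(C_\bullet,b,\tilde B)$ is a mixed complex. (2) The projection $\pi^T$ (acting on coefficients, $xu^p\mapsto\pi^T(x)u^p$) gives rise to an $S$-homotopy equivalence between $C^\natural$ and $\tilde C^\natural$ and to a $T$-homotopy equivalence between their periodic para-complexes.
   Context: $k$ is a unital ring, not assumed commutative; $k$-modules are left modules. A para-$S$-module $(C_\bullet,d,S,T)$ consists of $k$-modules $C_m$ ($m\ge 0$), $k$-linear maps $d:C_\bullet\to C_{\bullet-1}$, $S:C_\bullet\to C_{\bullet-2}$ and a $k$-linear isomorphism $T:C_\bullet\to C_\bullet$ such that $d^2=S(1-T)$ and $d,S,T$ commute pairwise. An $S$-map is a degree $0$ $k$-linear map commuting with $d,S,T$. An $S$-homotopy equivalence between para-$S$-modules $C,\bar C$ is given by $S$-maps $f:C_\bullet\to\bar C_\bullet$, $g:\bar C_\bullet\to C_\bullet$ such that $gf-1=d\varphi+\varphi d$ and $fg-1=d\psi+\psi d$ for $k$-linear maps $\varphi,\psi$ of degree $+1$ commuting with $S$ and $T$. A parachain complex $(C_\bullet,b,B)$ consists of $k$-modules $C_m$ ($m\ge0$) and $k$-linear maps $b:C_\bullet\to C_{\bullet-1}$, $B:C_\bullet\to C_{\bullet+1}$ with $b^2=0$, $B^2=0$,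 such that $T:=1-(bB+Bb)$ is an isomorphism. It is a mixed complex if $T=1$, i.e. $bB+Bb=0$. It is a quasi-mixed complex if $C_\bullet=\ker(1-T)\oplus\operatorname{ran}(1-T)$. For a parachain complex, $C^\natural_m=\bigoplus_{p\ge0,\,2p\le m}C_{m-2p}u^p$, where $u$ is a formal variable; $u^{-1}(xu^p)=xu^{p-1}$ for $p\ge1$ and $u^{-1}(xu^0)=0$; $b,B,T$ act on coefficients. $C^\natural=(C^\natural_\bullet,b+Bu^{-1},u^{-1},T)$ is a para-$S$-module. For $\tilde C$ the operator ''$T$'' is the identity. The periodic para-complex of a parachain complex $C$ is $C^\sharp=(C^\sharp_0\oplus C^\sharp_1,b+B,T)$ with $C_i^\sharp=\prod_{q\ge0}C_{2q+i}$, $i=0,1$. A $T$-homotopy equivalence between periodic para-complexes is a homotopy equivalence (with respect to the odd operators $b+B$ resp. $b+\tilde B$) in which all maps and homotopies commute with the $T$-operators. *)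

(* Defs.v *)
From HB Require Import structures.
From mathcomp Require Import all_boot all_order all_algebra.
From mathcomp Require Import boolp classical_sets.

Set Implicit Arguments.
Unset Strict Implicit.
Unset Printing Implicit Defensive.

Import GRing.Theory.
Local Open Scope ring_scope.
Local Open Scope classical_set_scope.

(* The library has the pointwise module structure on [I -> V], but not on a
   product of a family of modules.  Its equality and choice structures are the
   classical ones on dependent functions. *)
Definition famprod (I : Type) (V : I -> Type) : Type := forall i : I, V i.

Section DependentProduct.
Variables (k : pzRingType) (I : Type) (V : I -> lmodType k).
Implicit Types x y z : famprod V.

HB.instance Definition _ := Choice.copy (famprod V) (forall i : I, V i).

Let add x y : famprod V := fun i => x i + y i.
Let opp x : famprod V := fun i => - x i.
Let zero : famprod V := fun i => 0.
Let scale (a : k) x : famprod V := fun i => a *: x i.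

Fact famprod_addA : associative add.
Proof. by move=> x y z; apply: functional_extensionality_dep => i; exact: addrA. Qed.
Fact famprod_addC : commutative add.
Proof. by move=> x y; apply: functional_extensionality_dep => i; exact: addrC. Qed.
Fact famprod_add0 : left_id zero add.
Proof. by move=> x; apply: functional_extensionality_dep => i; exact: add0r. Qed.
Fact famprod_addN : left_inverse zero opp add.
Proof. by move=> x; apply: functional_extensionality_dep => i; exact: addNr. Qed.

HB.instance Definition _ := GRing.isZmodule.Build (famprod V)
  famprod_addA famprod_addC famprod_add0 famprod_addN.

Fact famprod_scaleA a b x : scale a (scale b x) = scale (a * b) x.
Proof. by apply: functional_extensionality_dep => i; exact: scalerA. Qed.
Fact famprod_scale1 : left_id 1 scale.
Proof. by move=> x; apply: functional_extensionality_dep => i; exact: scale1r. Qed.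
Fact famprod_scaleDr : right_distributive scale +%R.
Proof. by move=> a x y; apply: functional_extensionality_dep => i; exact: scalerDr. Qed.
Fact famprod_scaleDl x : {morph scale^~ x : a b / a + b}.
Proof. by move=> a b; apply: functional_extensionality_dep => i; exact: scalerDl. Qed.

HB.instance Definition _ := GRing.Zmodule_isLmodule.Build k (famprod V)
  famprod_scaleA famprod_scale1 famprod_scaleDr famprod_scaleDl.

Lemma famprodP x y : (forall i, x i = y i) -> x = y.
Proof. exact: functional_extensionality_dep. Qed.
Lemma famprodDE x y i : (x + y) i = x i + y i. Proof. by []. Qed.
Lemma famprodNE x i : (- x) i = - x i. Proof. by []. Qed.
Lemma famprod0E i : (0 : famprod V) i = 0. Proof. by []. Qed.
Lemma famprodZE a x i : (a *: x) i = a *: x i. Proof. by []. Qed.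

End DependentProduct.

Section DependentProductMap.
Variables (k : pzRingType) (I : Type) (V W : I -> lmodType k).
Variable f : forall i, {linear V i -> W i}.

Definition famprod_map (x : famprod V) : famprod W := fun i => f i (x i).

Fact famprod_map_linear : linear famprod_map.
Proof. by move=> a x y; apply: famprodP => i; exact: linearP. Qed.

HB.instance Definition _ := GRing.isLinear.Build k (famprod V) (famprod W) _
  famprod_map famprod_map_linear.

End DependentProductMap.

(* Modules graded by [nat] are zero in negative degrees, so the composite of a
   map lowering the degree and a map raising it vanishes on degree 0. *)
Section CompDown.
Variables (k : pzRingType) (U V W : nat -> lmodType k).
Variables (h : forall m, {linear V m -> W m.+1}).
Variables (d : forall m, {linear U m.+1 -> V m}).

Definition comp_down_fun m : U m -> W m :=
  match m with
  | 0%N => fun=> 0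
  | m'.+1 => fun x => h m' (d m' x)
  end.

Fact comp_down_linear m : linear (@comp_down_fun m).
Proof.
by case: m => [|m] a x y /=; rewrite ?scaler0 ?addr0 // !linearP.
Qed.

HB.instance Definition _ m := GRing.isLinear.Build k (U m) (W m) _
  (@comp_down_fun m) (@comp_down_linear m).

Definition comp_down m : {linear U m -> W m} := @comp_down_fun m.

End CompDown.

Definition is_direct_sum (k : pzRingType) (V : lmodType k) (A D : set V) : Prop :=
  (forall x, exists2 y, A y & D (x - y)) /\ A `&` D `<=` [set 0].

Definition ker (k : pzRingType) (V W : lmodType k) (u : {linear V -> W}) : set V :=
  [set x | u x = 0].

Section KernelProjection.
Variables (k : pzRingType) (V : lmodType k) (u : {linear V -> V}).
Hypothesis dsu : is_direct_sum (ker u) (range u).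

Definition ker_proj (x : V) : V := s2val (cid2 (dsu.1 x)).

Lemma ker_proj_ker x : u (ker_proj x) = 0.
Proof. by rewrite /ker_proj; case: cid2. Qed.

Lemma ker_proj_ran x : exists z, u z = x - ker_proj x.
Proof. by rewrite /ker_proj; case: cid2 => y /= _ [z _ <-]; exists z. Qed.

Lemma ker_proj_unique x y z : u y = 0 -> u z = x - y -> ker_proj x = y.
Proof.
move=> uy0 uz; have [z' uz'] := ker_proj_ran x.
apply/eqP; rewrite -subr_eq0; apply/eqP; apply: dsu.2; split => /=.
  by rewrite /ker /= linearB ker_proj_ker uy0 subr0.
by exists (z - z') => //; rewrite linearB uz uz' opprB addrC addrA subrK.
Qed.

Fact ker_proj_linear : linear ker_proj.
Proof.
move=> a x y; have [z1 e1] := ker_proj_ran x; have [z2 e2] := ker_proj_ran y.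
apply: (@ker_proj_unique _ _ (a *: z1 + z2)).
  by rewrite linearP !ker_proj_ker scaler0 addr0.
by rewrite linearP e1 e2 scalerBr opprD addrACA.
Qed.

HB.instance Definition _ :=
  GRing.isLinear.Build k V V _ ker_proj ker_proj_linear.

End KernelProjection.

(* Identities between maps into negative degrees are vacuous. *)
Record paraSmod (k : pzRingType) := ParaSmod {
  ps_mod :> nat -> lmodType k;
  ps_d : forall m, {linear ps_mod m.+1 -> ps_mod m};
  ps_S : forall m, {linear ps_mod m.+2 -> ps_mod m};
  ps_T : forall m, {linear ps_mod m -> ps_mod m};
  ps_Tiso : forall m, bijective (ps_T m);
  ps_dd : forall m (x : ps_mod m.+2),
    ps_d m (ps_d m.+1 x) = ps_S m (x - ps_T m.+2 x);
  ps_dS : forall m (x : ps_mod m.+3),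
    ps_d m (ps_S m.+1 x) = ps_S m (ps_d m.+2 x);
  ps_dT : forall m (x : ps_mod m.+1),
    ps_d m (ps_T m.+1 x) = ps_T m (ps_d m x);
  ps_ST : forall m (x : ps_mod m.+2),
    ps_S m (ps_T m.+2 x) = ps_T m (ps_S m x)
}.
Arguments ps_d {k} p m.
Arguments ps_S {k} p m.
Arguments ps_T {k} p m.

Section SHomotopy.
Variable k : pzRingType.
Implicit Types C D : paraSmod k.

Definition is_Smap C D (f : forall m, {linear C m -> D m}) : Prop :=
  [/\ forall m (x : C m.+1), f m (ps_d C m x) = ps_d D m (f m.+1 x),
      forall m (x : C m.+2), f m (ps_S C m x) = ps_S D m (f m.+2 x)
    & forall m (x : C m), f m (ps_T C m x) = ps_T D m (f m x)].

(* A map of degree +1 commuting with [S] and [T].  In degree 1, [phi S] vanishes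
   because [S] maps into degree -1, while [S phi] maps degree 1 to degree 0. *)
Definition commutes_ST C (phi : forall m, {linear C m -> C m.+1}) : Prop :=
  [/\ forall m (x : C m.+2), phi m (ps_S C m x) = ps_S C m.+1 (phi m.+2 x),
      forall x : C 1%N, ps_S C 0%N (phi 1%N x) = 0
    & forall m (x : C m), phi m (ps_T C m x) = ps_T C m.+1 (phi m x)].

Definition S_homotopic_to_id C (h : forall m, C m -> C m) : Prop :=
  exists2 phi : forall m, {linear C m -> C m.+1}, commutes_ST phi &
    forall m (x : C m),
      h m x - x = ps_d C m (phi m x) + comp_down phi (ps_d C) m x.

Definition S_homotopy_equivalence C D (f : forall m, {linear C m -> D m})
    (g : forall m, {linear D m -> C m}) : Prop :=
  [/\ is_Smap f, is_Smap g,
      @S_homotopic_to_id C (fun m x => g m (f m x))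
    & @S_homotopic_to_id D (fun m x => f m (g m x))].

End SHomotopy.

Definition twist (k : pzRingType) (V : nat -> lmodType k)
    (b : forall m, {linear V m.+1 -> V m}) (B : forall m, {linear V m -> V m.+1})
    (m : nat) : {linear V m -> V m} :=
  idfun \- ((b m \o B m) \+ comp_down B b m).

Definition is_parachain (k : pzRingType) (V : nat -> lmodType k)
    (b : forall m, {linear V m.+1 -> V m})
    (B : forall m, {linear V m -> V m.+1}) : Prop :=
  [/\ forall m (x : V m.+2), b m (b m.+1 x) = 0,
      forall m (x : V m), B m.+1 (B m x) = 0
    & forall m, bijective (twist b B m)].

Record parachain (k : pzRingType) := Parachain {
  pc_mod :> nat -> lmodType k;
  pc_b : forall m, {linear pc_mod m.+1 -> pc_mod m};
  pc_B : forall m, {linear pc_mod m -> pc_mod m.+1};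
  pc_axioms : is_parachain pc_b pc_B
}.
Arguments pc_b {k} p m.
Arguments pc_B {k} p m.

Definition pc_T (k : pzRingType) (C : parachain k) (m : nat) :
  {linear C m -> C m} := twist (pc_b C) (pc_B C) m.

Definition pc_1T (k : pzRingType) (C : parachain k) (m : nat) :
  {linear C m -> C m} := idfun \- pc_T C m.

Definition is_mixed (k : pzRingType) (C : parachain k) : Prop :=
  forall m (x : C m), pc_T C m x = x.

Definition is_quasi_mixed (k : pzRingType) (C : parachain k) : Prop :=
  forall m, is_direct_sum (ker (pc_1T C m)) (range (pc_1T C m)).

Definition piT (k : pzRingType) (C : parachain k) (qC : is_quasi_mixed C)
  (m : nat) : {linear C m -> C m} := ker_proj (qC m).

Definition Btilde (k : pzRingType) (C : parachain k) (qC : is_quasi_mixed C)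
  (m : nat) : {linear C m -> C m.+1} := piT qC m.+1 \o pc_B C m.

Section ParachainTheory.
Variables (k : pzRingType) (C : parachain k).

Lemma pc_bb m (x : C m.+2) : pc_b C m (pc_b C m.+1 x) = 0.
Proof. by case: (pc_axioms C). Qed.

Lemma pc_BB m (x : C m) : pc_B C m.+1 (pc_B C m x) = 0.
Proof. by case: (pc_axioms C). Qed.

Lemma pc_T_bij m : bijective (pc_T C m).
Proof. by case: (pc_axioms C). Qed.

Lemma pc_TE m (x : C m) :
  pc_T C m x = x - (pc_b C m (pc_B C m x) + comp_down (pc_B C) (pc_b C) m x).
Proof. by []. Qed.

Lemma pc_bT m (x : C m.+1) : pc_b C m (pc_T C m.+1 x) = pc_T C m (pc_b C m x).
Proof.
rewrite !pc_TE linearB linearD /= pc_bb add0r; congr (_ - _).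
by case: m x => [|m] x /=; rewrite ?pc_bb ?linear0 addr0.
Qed.

Lemma pc_BT m (x : C m) : pc_B C m (pc_T C m x) = pc_T C m.+1 (pc_B C m x).
Proof.
rewrite !pc_TE linearB linearD /= pc_BB linear0 add0r; congr (_ - _).
by case: m x => [|m] x /=; rewrite ?pc_BB ?linear0 addr0.
Qed.

End ParachainTheory.

(* An index [Bideg q p _] of type [bideg m] stands for the monomials [x u^p]
   of degree [m] with [x] of degree [q = m - 2p]. *)
Record bideg (m : nat) := Bideg {
  cdeg : nat;
  udeg : nat;
  bidegE : (cdeg + udeg.*2)%N = m
}.

(* The set of pairs [(q, p)] with [q + 2p = m] is finite: the product of the
   [V q] over it is the direct sum of the [V (m - 2p) u^p]. *)
Definition nat_mod (k : pzRingType) (V : nat -> lmodType k) (m : nat) :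
  lmodType k := famprod (fun i : bideg m => V (cdeg i)).

Section Natural.
Variables (k : pzRingType).

Definition nat_map (V W : nat -> lmodType k) (f : forall m, {linear V m -> W m})
  (m : nat) : {linear nat_mod V m -> nat_mod W m} :=
  famprod_map (fun i : bideg m => f (cdeg i)).

Variable V : nat -> lmodType k.

Fact bideg_cS m q p : (q + p.*2)%N = m -> (q.+1 + p.*2)%N = m.+1.
Proof. by move=> <-. Qed.
Fact bideg_cP m q p : (q.+1 + p.*2)%N = m.+1 -> (q + p.*2)%N = m.
Proof. by move=> [<-]. Qed.
Fact bideg_uS m q p : (q + p.*2)%N = m -> (q + p.+1.*2)%N = m.+2.
Proof. by move=> <-; rewrite doubleS !addnS. Qed.

Definition nat_b_fun (b : forall m, {linear V m.+1 -> V m}) (m : nat)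
    (x : nat_mod V m.+1) : nat_mod V m :=
  fun i => let: Bideg q p e := i in b q (x (Bideg (bideg_cS e))).

Definition nat_B_fun (B : forall m, {linear V m -> V m.+1}) (m : nat)
    (x : nat_mod V m) : nat_mod V m.+1 :=
  fun i => let: Bideg q p e := i in
    match q return (q + p.*2)%N = m.+1 -> V q with
    | 0%N => fun=> 0
    | q'.+1 => fun e => B q' (x (Bideg (bideg_cP e)))
    end e.

Definition nat_uinv_fun (m : nat) (x : nat_mod V m.+2) : nat_mod V m :=
  fun i => let: Bideg q p e := i in x (Bideg (bideg_uS e)).

Fact nat_b_linear b m : linear (@nat_b_fun b m).
Proof. by move=> a x y; apply: famprodP => -[q p e]; exact: linearP. Qed.
Fact nat_B_linear B m : linear (@nat_B_fun B m).
Proof.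
move=> a x y; apply: famprodP => -[[|q] p e] /=; last exact: linearP.
by rewrite [RHS]famprodDE famprodZE /= scaler0 addr0.
Qed.
Fact nat_uinv_linear m : linear (@nat_uinv_fun m).
Proof. by move=> a x y; apply: famprodP => -[q p e]. Qed.

HB.instance Definition _ b m := GRing.isLinear.Build k (nat_mod V m.+1)
  (nat_mod V m) _ (@nat_b_fun b m) (@nat_b_linear b m).
HB.instance Definition _ B m := GRing.isLinear.Build k (nat_mod V m)
  (nat_mod V m.+1) _ (@nat_B_fun B m) (@nat_B_linear B m).
HB.instance Definition _ m := GRing.isLinear.Build k (nat_mod V m.+2)
  (nat_mod V m) _ (@nat_uinv_fun m) (@nat_uinv_linear m).

Definition nat_b b m : {linear nat_mod V m.+1 -> nat_mod V m} :=
  @nat_b_fun b m.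
Definition nat_B B m : {linear nat_mod V m -> nat_mod V m.+1} :=
  @nat_B_fun B m.
Definition nat_uinv m : {linear nat_mod V m.+2 -> nat_mod V m} :=
  @nat_uinv_fun m.

Definition nat_Buinv B m : {linear nat_mod V m.+1 -> nat_mod V m} :=
  @comp_down k (fun m => nat_mod V m.+1) (nat_mod V) (nat_mod V)
    (nat_B B) nat_uinv m.

Definition nat_d b B m : {linear nat_mod V m.+1 -> nat_mod V m} :=
  nat_b b m \+ nat_Buinv B m.

End Natural.

Section NaturalParaS.
Variables (k : pzRingType) (C : parachain k).
Let d := nat_d (pc_b C) (pc_B C).
Let T := nat_map (pc_T C).
Let S := nat_uinv C.

Fact bideg_cSu m q p : (q.+1 + p.*2)%N = m -> (q + p.+1.*2)%N = m.+1.
Proof. by move=> <-; rewrite doubleS !addnS. Qed.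

Lemma nat_dE m (x : nat_mod C m.+1) q p (e : (q + p.*2)%N = m) :
  d m x (Bideg e) = pc_b C q (x (Bideg (bideg_cS e))) +
    match q return (q + p.*2)%N = m -> C q with
    | 0%N => fun=> 0
    | q'.+1 => fun e => pc_B C q' (x (Bideg (bideg_cSu e)))
    end e.
Proof.
rewrite /d /nat_d /=; congr (_ + _).
case: m x e => [|m] x e; first by case: q e => // q [].
case: q e => [|q] e //=; congr (pc_B C q (x (Bideg _))).
exact: eq_irrelevance.
Qed.

Fact nat_T_bij m : bijective (T m).
Proof.
have inv q : {g : C q -> C q | cancel (pc_T C q) g & cancel g (pc_T C q)}.
  by apply: cid2; case: (pc_T_bij C q) => g; exists g.
exists (fun x i => s2val (inv (cdeg i)) (x i)) => x; apply: famprodP => i;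
  rewrite /T /= /famprod_map; case: (inv _) => g gK Kg /=; [exact: gK|exact: Kg].
Qed.

Fact nat_dd m (x : nat_mod C m.+2) : d m (d m.+1 x) = S m (x - T m.+2 x).
Proof.
apply: famprodP => -[q p e]; rewrite nat_dE nat_dE linearD pc_bb add0r.
have -> : S m (x - T m.+2 x) (Bideg e) =
    x (Bideg (bideg_uS e)) - pc_T C q (x (Bideg (bideg_uS e))) by [].
rewrite pc_TE opprB [RHS]addrC subrK.
rewrite (eq_irrelevance (bideg_cSu (bideg_cS e)) (bideg_uS e)).
congr (_ + _); case: q e => [|q] e; first by [].
transitivity (pc_B C q (d m.+1 x (Bideg (bideg_cSu e)))) => //.
rewrite nat_dE linearD.
rewrite (eq_irrelevance (bideg_cS (bideg_cSu e)) (bideg_uS e)).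
by case: q e => [|q] e /=; rewrite ?linear0 ?pc_BB addr0.
Qed.

Fact nat_dS m (x : nat_mod C m.+3) : d m (S m.+1 x) = S m (d m.+2 x).
Proof.
apply: famprodP => -[q p e].
transitivity (d m.+2 x (Bideg (bideg_uS e))) => //; rewrite !nat_dE /=.
congr (_ + _); first by congr (pc_b C q (x (Bideg _))); exact: eq_irrelevance.
by case: q e => [|q] e //=; congr (pc_B C q (x (Bideg _)));
  exact: eq_irrelevance.
Qed.

Fact nat_dT m (x : nat_mod C m.+1) : d m (T m.+1 x) = T m (d m x).
Proof.
apply: famprodP => -[q p e].
transitivity (pc_T C q (d m x (Bideg e))) => //.
rewrite !nat_dE (linearD (pc_T C q)).
congr (_ + _); first exact: pc_bT.
by case: q e => [|q] e; [rewrite linear0 | exact: pc_BT].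
Qed.

Fact nat_ST m (x : nat_mod C m.+2) : S m (T m.+2 x) = T m (S m x).
Proof. by apply: famprodP => -[q p e]. Qed.

Definition natural : paraSmod k := ParaSmod nat_T_bij nat_dd nat_dS nat_dT nat_ST.

End NaturalParaS.

Record paracomplex (k : pzRingType) := Paracomplex {
  pd_even : lmodType k;
  pd_odd : lmodType k;
  pd_d0 : {linear pd_even -> pd_odd};
  pd_d1 : {linear pd_odd -> pd_even};
  pd_T0 : {linear pd_even -> pd_even};
  pd_T1 : {linear pd_odd -> pd_odd}
}.

Section THomotopy.
Variable k : pzRingType.
Implicit Types C D : paracomplex k.

Definition is_Tmap C D (f0 : {linear pd_even C -> pd_even D})
    (f1 : {linear pd_odd C -> pd_odd D}) : Prop :=
  [/\ forall x, f1 (pd_d0 C x) = pd_d0 D (f0 x),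
      forall x, f0 (pd_d1 C x) = pd_d1 D (f1 x),
      forall x, f0 (pd_T0 C x) = pd_T0 D (f0 x)
    & forall x, f1 (pd_T1 C x) = pd_T1 D (f1 x)].

Definition T_homotopic_to_id C (h0 : pd_even C -> pd_even C)
    (h1 : pd_odd C -> pd_odd C) : Prop :=
  exists (phi0 : {linear pd_even C -> pd_odd C})
         (phi1 : {linear pd_odd C -> pd_even C}),
  [/\ forall x, phi0 (pd_T0 C x) = pd_T1 C (phi0 x),
      forall x, phi1 (pd_T1 C x) = pd_T0 C (phi1 x),
      forall x, h0 x - x = pd_d1 C (phi0 x) + phi1 (pd_d0 C x)
    & forall x, h1 x - x = pd_d0 C (phi1 x) + phi0 (pd_d1 C x)].

Definition T_homotopy_equivalence C D
    (f0 : {linear pd_even C -> pd_even D}) (f1 : {linear pd_odd C -> pd_odd D})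
    (g0 : {linear pd_even D -> pd_even C}) (g1 : {linear pd_odd D -> pd_odd C}) :
    Prop :=
  [/\ is_Tmap f0 f1, is_Tmap g0 g1,
      T_homotopic_to_id (g0 \o f0) (g1 \o f1)
    & T_homotopic_to_id (f0 \o g0) (f1 \o g1)].

End THomotopy.

Section Sharp.
Variable k : pzRingType.

(* [i + q.*2] rather than [q.*2 + i], so that [1 + q.*2] is convertible to the
   successor of [0 + q.*2]. *)
Definition sharp_mod (V : nat -> lmodType k) (i : nat) : lmodType k :=
  famprod (fun q : nat => V (i + q.*2)%N).

Definition sharp_map (V W : nat -> lmodType k) (f : forall m, {linear V m -> W m})
  (i : nat) : {linear sharp_mod V i -> sharp_mod W i} :=
  famprod_map (fun q : nat => f (i + q.*2)%N).

Variable C : parachain k.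

Definition sharp_d0_fun (x : sharp_mod C 0) : sharp_mod C 1 :=
  fun q => pc_b C (1 + q.*2)%N (x q.+1) + pc_B C (0 + q.*2)%N (x q).

Definition sharp_d1_fun (x : sharp_mod C 1) : sharp_mod C 0 :=
  fun q => pc_b C (0 + q.*2)%N (x q) +
    match q return C (0 + q.*2)%N with
    | 0%N => 0
    | q'.+1 => pc_B C (1 + q'.*2)%N (x q')
    end.

Fact sharp_d0_linear : linear sharp_d0_fun.
Proof.
move=> a x y; apply: famprodP => q.
by rewrite famprodDE famprodZE /sharp_d0_fun !linearP scalerDr addrACA.
Qed.

Fact sharp_d1_linear : linear sharp_d1_fun.
Proof.
move=> a x y; apply: famprodP => q; rewrite famprodDE famprodZE /sharp_d1_fun.
by case: q => [|q]; rewrite !linearP ?addr0 // scalerDr addrACA.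
Qed.

HB.instance Definition _ := GRing.isLinear.Build k (sharp_mod C 0)
  (sharp_mod C 1) _ sharp_d0_fun sharp_d0_linear.
HB.instance Definition _ := GRing.isLinear.Build k (sharp_mod C 1)
  (sharp_mod C 0) _ sharp_d1_fun sharp_d1_linear.

Definition sharp : paracomplex k := Paracomplex sharp_d0_fun sharp_d1_fun
  (sharp_map (pc_T C) 0) (sharp_map (pc_T C) 1).

End Sharp.

(* Main.v *)
Require Import Defs.
From HB Require Import structures.
From mathcomp Require Import all_boot all_order all_algebra.
From mathcomp Require Import boolp classical_sets.

(** Write [D = 1 - T = b B + B b] and let [P] be the projection onto [ker D].

    The splitting makes [D] bijective on [ran D], so [D] has a group inverse:
    the linear map [G] that inverts [D] on [ran D] and vanishes on [ker D]
    ([ker_inv]), which satisfies [G D = 1 - P].  As [P] and [G] are determined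
    by [D], every map intertwining two such operators also intertwines their
    projections and group inverses ([ker_proj_natural], [ker_inv_natural]); in
    particular [P] and [G] commute with [b] and [B].  Hence
    [b (P B) + (P B) b = P D = 0], which is the first claim.

    Since [P] commutes with [b], is idempotent, and satisfies [P B = B P], it
    is a morphism of parachain complexes from [(b, B)] to [(b, P B)] and back.
    Both composites are [P P = P], and the same map [phi = - G B] of degree +1
    contracts [P] to the identity on both sides:
    [b phi + phi b = - G (b B + B b) = - G D = P - 1], while [phi] is killed on
    either side by [B], because [B B = 0], and so by [P B].  The terms
    involving [B] therefore drop out of [d phi + phi d], both for
    [d = b + B u^-1] on [u]-polynomials and for [d = b + B] on products
    ([natural_homotopic_to_id], [sharp_homotopic_to_id]). *)

Set Implicit Arguments.
Unset Strict Implicit.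
Unset Printing Implicit Defensive.

Import GRing.Theory.
Local Open Scope ring_scope.
Local Open Scope classical_set_scope.

(** * The group inverse of an endomorphism with split kernel and range *)

Section KernelInverse.
Variables (k : pzRingType) (V : lmodType k) (u : {linear V -> V}).
Hypothesis dsu : is_direct_sum (ker u) (range u).

Lemma ker_proj_id x : u x = 0 -> ker_proj dsu x = x.
Proof.
move=> ux0.
by rewrite (ker_proj_unique dsu (y := x) (z := 0)) // linear0 subrr.
Qed.

Lemma ker_proj_idem x : ker_proj dsu (ker_proj dsu x) = ker_proj dsu x.
Proof. by apply: ker_proj_id; exact: ker_proj_ker. Qed.

Lemma ker_proj_range x : ker_proj dsu (u x) = 0.
Proof. by apply: (ker_proj_unique dsu (z := x)); rewrite ?subr0 ?linear0. Qed.

(** A preimage [z] of [x - P x] may be replaced by [z - P z], which lies in the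
    range of [u]. *)
Fact ker_inv_exists x :
  exists2 y, ker_proj dsu y = 0 & u y = x - ker_proj dsu x.
Proof.
have [z uz] := ker_proj_ran dsu x; exists (z - ker_proj dsu z).
  by rewrite linearB /= ker_proj_idem subrr.
by rewrite linearB ker_proj_ker subr0.
Qed.

Definition ker_inv (x : V) : V := s2val (cid2 (ker_inv_exists x)).

Lemma ker_proj_inv x : ker_proj dsu (ker_inv x) = 0.
Proof. by rewrite /ker_inv; case: cid2. Qed.

Lemma ker_invK x : u (ker_inv x) = x - ker_proj dsu x.
Proof. by rewrite /ker_inv; case: cid2. Qed.

(** The two conditions determine [y] because [u] is injective on its range. *)
Lemma ker_inv_unique x y :
  ker_proj dsu y = 0 -> u y = x - ker_proj dsu x -> ker_inv x = y.
Proof.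
move=> Py0 uy; apply/eqP; rewrite -subr_eq0; apply/eqP.
rewrite -(@ker_proj_id (ker_inv x - y)).
  by rewrite linearB /= ker_proj_inv Py0 subrr.
by rewrite linearB ker_invK uy subrr.
Qed.

Fact ker_inv_linear : linear ker_inv.
Proof.
move=> a x y; apply: ker_inv_unique.
  by rewrite linearP /= !ker_proj_inv scaler0 addr0.
by rewrite !linearP !ker_invK scalerDr addrACA.
Qed.

HB.instance Definition _ := GRing.isLinear.Build k V V _ ker_inv ker_inv_linear.

Lemma ker_inv_range x : ker_inv (u x) = x - ker_proj dsu x.
Proof.
apply: ker_inv_unique; first by rewrite linearB /= ker_proj_idem subrr.
by rewrite linearB ker_proj_ker ker_proj_range.
Qed.

End KernelInverse.

Section KernelNaturality.
Variables (k : pzRingType) (V W : lmodType k).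
Variables (u : {linear V -> V}) (v : {linear W -> W}) (a : {linear V -> W}).
Hypotheses (dsu : is_direct_sum (ker u) (range u)).
Hypotheses (dsv : is_direct_sum (ker v) (range v)).
Hypothesis auv : forall x, a (u x) = v (a x).

(** [a] carries the decomposition of [x] into kernel and range parts to one of
    [a x], and such a decomposition is unique. *)
Lemma ker_proj_natural x : a (ker_proj dsu x) = ker_proj dsv (a x).
Proof.
have [z uz] := ker_proj_ran dsu x; apply/esym.
apply: (ker_proj_unique dsv (z := a z)).
  by rewrite -auv ker_proj_ker linear0.
by rewrite -auv uz linearB.
Qed.

Lemma ker_inv_natural x : a (ker_inv dsu x) = ker_inv dsv (a x).
Proof.
apply/esym/ker_inv_unique.
  by rewrite -ker_proj_natural ker_proj_inv linear0.
by rewrite -auv ker_invK linearB ker_proj_natural.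
Qed.

End KernelNaturality.

(** * Maps of parachain complexes *)

Section ParachainMap.
Variables (k : pzRingType) (C D : parachain k).
Variable f : forall m, {linear C m -> D m}.
Hypothesis fb : forall m (x : C m.+1), f m (pc_b C m x) = pc_b D m (f m.+1 x).
Hypothesis fB : forall m (x : C m), f m.+1 (pc_B C m x) = pc_B D m (f m x).

(** [T] is a polynomial in [b] and [B]. *)
Lemma parachain_mapT m (x : C m) : f m (pc_T C m x) = pc_T D m (f m x).
Proof.
rewrite !pc_TE linearB linearD fb fB; congr (_ - (_ + _)).
by case: m x => [|m] x; rewrite ?linear0 // /comp_down /= fB fb.
Qed.

Lemma natural_map_Smap : @is_Smap k (natural C) (natural D) (nat_map f).
Proof.
split=> m x; apply: famprodP => -[q p e].
- rewrite [RHS]nat_dE [LHS](congr1 (f q) (nat_dE x e)) linearD fb.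
  by congr (_ + _); case: q e => [|q] e; [exact: linear0 | exact: fB].
- by [].
- exact: parachain_mapT.
Qed.

Lemma sharp_map_Tmap :
  @is_Tmap k (sharp C) (sharp D) (sharp_map f 0) (sharp_map f 1).
Proof.
split=> x; apply: famprodP => q.
- by rewrite /= /famprod_map /sharp_d0_fun linearD fb fB.
- rewrite /= /famprod_map /sharp_d1_fun linearD fb; congr (_ + _).
  by case: q => [|q]; [exact: linear0 | exact: fB].
- exact: parachain_mapT.
- exact: parachain_mapT.
Qed.

End ParachainMap.

(** * Homotopies annihilated by B *)

Section HomotopyToId.
Variables (k : pzRingType) (C : parachain k).
Variables (h : forall m, {linear C m -> C m}).
Variables (H : forall m, {linear C m -> C m.+1}).
Hypothesis HT : forall m (x : C m), H m (pc_T C m x) = pc_T C m.+1 (H m x).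
Hypothesis BH : forall m (x : C m), pc_B C m.+1 (H m x) = 0.
Hypothesis HB : forall m (x : C m), H m.+1 (pc_B C m x) = 0.
Hypothesis bH : forall m (x : C m),
  h m x - x = pc_b C m (H m x) + comp_down H (pc_b C) m x.

(** Applying [H] to coefficients is a homotopy on [u]-polynomials: its
    anticommutator with [B u^-1] is [(B H + H B) u^-1 = 0].  The construction
    that lets [B] act on coefficients makes sense for any map of degree +1, so
    it also serves for [H]. *)
Lemma natural_homotopic_to_id :
  @S_homotopic_to_id k (natural C) (nat_map h).
Proof.
exists (nat_B H).
  split.
  - move=> m x; apply: famprodP => -[[|q] p e] //=.
    by congr (H q (x (Bideg _))); exact: eq_irrelevance.
  (* The only index in degree 0 has coefficient degree 0, where [H] cannot
     land. *)
  - by move=> x; apply: famprodP => -[[|q] p e].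
  - move=> m x; apply: famprodP => -[[|q] p e]; last exact: HT.
    exact/esym/(linear0 (pc_T C 0)).
move=> m x; apply: famprodP => -[q p e].
transitivity (h q (x (Bideg e)) - x (Bideg e)) => //.
rewrite bH famprodDE nat_dE; congr (_ + _); last first.
  case: q e => [|q] e; first by case: m x e.
  case: m x e => [//|m] x e.
  transitivity (H q (nat_d (pc_b C) (pc_B C) m x (Bideg (bideg_cP e)))) => //.
  rewrite nat_dE linearD (eq_irrelevance (bideg_cS (bideg_cP e)) e).
  rewrite -[LHS]addr0; congr (_ + _).
  case: q e => [|q] e; rewrite ?linear0 //; exact/esym/HB.
have -> : nat_B H m x (Bideg (bideg_cS e)) = H q (x (Bideg e)).
  by rewrite /=; congr (H q (x (Bideg _))); exact: eq_irrelevance.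
rewrite -[LHS]addr0; congr (_ + _).
case: q e => [//|[|q]] e /=; first by rewrite linear0.
exact/esym/BH.
Qed.

Definition sharp_shift_fun (x : sharp_mod C 1) : sharp_mod C 0 :=
  fun q => match q return C (0 + q.*2)%N with
    | 0%N => 0
    | q'.+1 => H (1 + q'.*2)%N (x q')
    end.

Fact sharp_shift_linear : linear sharp_shift_fun.
Proof.
move=> a x y; apply: famprodP => -[|q]; rewrite famprodDE famprodZE /=.
  by rewrite scaler0 addr0.
exact: linearP.
Qed.

HB.instance Definition _ := GRing.isLinear.Build k (sharp_mod C 1)
  (sharp_mod C 0) _ sharp_shift_fun sharp_shift_linear.

Lemma sharp_homotopic_to_id :
  @T_homotopic_to_id k (sharp C) (sharp_map h 0) (sharp_map h 1).
Proof.
pose phi0 : {linear sharp_mod C 0 -> sharp_mod C 1} :=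
  @famprod_map k nat (fun q => C (0 + q.*2)%N) (fun q => C (1 + q.*2)%N)
    (fun q => H (0 + q.*2)%N).
exists phi0, sharp_shift_fun; split=> x; apply: famprodP => q.
- exact: HT.
- by case: q => [|q]; [exact/esym/(linear0 (pc_T C 0)) | exact: HT].
- transitivity (h (0 + q.*2)%N (x q) - x q) => //.
  rewrite bH famprodDE /= /sharp_d1_fun /phi0 /famprod_map /= -addrA.
  congr (_ + _); case: q => [|q]; first by rewrite addr0.
  by rewrite /= /sharp_d0_fun BH linearD HB addr0 add0r.
- transitivity (h (1 + q.*2)%N (x q) - x q) => //.
  rewrite bH famprodDE /= /sharp_d0_fun /phi0 /famprod_map /= -addrA.
  congr (_ + _); rewrite /sharp_d1_fun linearD /=.
  by case: q => [|q]; rewrite ?linear0 ?BH ?HB ?addr0 ?add0r.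
Qed.

End HomotopyToId.

(** * Quasi-mixed complexes *)

Section QuasiMixed.
Variables (k : pzRingType) (C : parachain k) (qC : is_quasi_mixed C).

Let b := pc_b C.
Let B := pc_B C.
Let P := piT qC.
Let D := pc_1T C.
Let G m : {linear C m -> C m} := ker_inv (qC m).

Lemma pc_1TE m (x : C m) : D m x = b m (B m x) + comp_down B b m x.
Proof.
by rewrite [LHS](_ : _ = x - pc_T C m x) // pc_TE opprB addrC subrK.
Qed.

Lemma pc_1Tb m (x : C m.+1) : b m (D m.+1 x) = D m (b m x).
Proof. by rewrite [in LHS]/D [LHS]linearB [X in _ - X]pc_bT. Qed.

Lemma pc_1TB m (x : C m) : B m (D m x) = D m.+1 (B m x).
Proof. by rewrite [in LHS]/D [LHS]linearB [X in _ - X]pc_BT. Qed.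

Lemma piTb m (x : C m.+1) : P m (b m x) = b m (P m.+1 x).
Proof. exact/esym/ker_proj_natural/pc_1Tb. Qed.

Lemma piTB m (x : C m) : P m.+1 (B m x) = B m (P m x).
Proof. exact/esym/ker_proj_natural/pc_1TB. Qed.

Lemma Btilde_piT m (x : C m) : Btilde qC m (P m x) = Btilde qC m x.
Proof. by rewrite /= -piTB; exact: ker_proj_idem. Qed.

Lemma piT_Btilde m (x : C m) : P m.+1 (Btilde qC m x) = Btilde qC m x.
Proof. exact: ker_proj_idem. Qed.

(** [b (P B) + (P B) b = P (b B + B b) = P (1 - T)], and [P] kills the range of
    [1 - T]. *)
Lemma twist_Btilde m (x : C m) : twist (pc_b C) (Btilde qC) m x = x.
Proof.
suff e : b m (Btilde qC m x) + comp_down (Btilde qC) b m x = 0.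
  by rewrite /= [X in _ - X]e subr0.
rewrite -(ker_proj_range (qC m) x) pc_1TE linearD /= -/(P _ _).
by congr (_ + _); [rewrite -piTb | case: m x => [|m] x //; rewrite linear0].
Qed.

Lemma Btilde_parachain : is_parachain (pc_b C) (Btilde qC).
Proof.
split=> [m x|m x|m]; first exact: pc_bb.
  by rewrite [LHS]Btilde_piT /= pc_BB linear0.
by exists id => x; rewrite twist_Btilde.
Qed.

Definition contracting_homotopy m : {linear C m -> C m.+1} :=
  \- (G m.+1 \o B m).

Let phi := contracting_homotopy.

Lemma phiE m (x : C m) : phi m x = - G m.+1 (B m x).
Proof. by []. Qed.

Lemma ker_inv_b m (x : C m.+1) : b m (G m.+1 x) = G m (b m x).
Proof. exact/ker_inv_natural/pc_1Tb. Qed.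

Lemma ker_inv_B m (x : C m) : B m (G m x) = G m.+1 (B m x).
Proof. exact/ker_inv_natural/pc_1TB. Qed.

Lemma B_phi m (x : C m) : B m.+1 (phi m x) = 0.
Proof. by rewrite phiE linearN ker_inv_B [B _ _]pc_BB linear0 oppr0. Qed.

Lemma phi_B m (x : C m) : phi m.+1 (B m x) = 0.
Proof. by rewrite phiE [B _ _]pc_BB linear0 oppr0. Qed.

Lemma Btilde_phi m (x : C m) : Btilde qC m.+1 (phi m x) = 0.
Proof. by rewrite [LHS](congr1 (P m.+2) (B_phi x)) linear0. Qed.

Lemma phi_Btilde m (x : C m) : phi m.+1 (Btilde qC m x) = 0.
Proof. by rewrite [Btilde qC m x]piTB phi_B. Qed.

(** Since [G] commutes with [b], the right-hand side is
    [- G (b B + B b) x = - G (1 - T) x]. *)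
Lemma phi_homotopy m (x : C m) :
  P m (P m x) - x = b m (phi m x) + comp_down phi b m x.
Proof.
rewrite [P m (P m x)]ker_proj_idem phiE linearN ker_inv_b.
have -> : comp_down phi b m x = - G m (comp_down B b m x).
  by case: m x => [|m] x //=; rewrite linear0 oppr0.
by rewrite -opprD -linearD -pc_1TE /= ker_inv_range opprB.
Qed.

Lemma phi_T m (x : C m) : phi m (pc_T C m x) = pc_T C m.+1 (phi m x).
Proof.
rewrite !phiE [B _ _]pc_BT linearN; congr (- _); apply/esym.
apply: (@ker_inv_natural _ _ _ _ _ (pc_T C m.+1)) => y.
exact: (linearB (pc_T C m.+1) y (pc_T C m.+1 y)).
Qed.

End QuasiMixed.

Theorem proposition3p10 (k : pzRingType) (C : parachain k)
    (qC : is_quasi_mixed C) :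
  exists parCt : is_parachain (pc_b C) (Btilde qC),
  let Ct : parachain k := Parachain parCt in
  [/\ is_mixed Ct,
      @S_homotopy_equivalence k (natural C) (natural Ct)
        (nat_map (piT qC)) (nat_map (piT qC))
    & @T_homotopy_equivalence k (sharp C) (sharp Ct)
        (sharp_map (piT qC) 0) (sharp_map (piT qC) 1)
        (sharp_map (piT qC) 0) (sharp_map (piT qC) 1)].
Proof.
exists (Btilde_parachain qC) => Ct.
(* [Ct] has the modules of [C] but another [B]: the projection and the homotopy
   are retyped so that unification picks the intended complex. *)
pose P m : {linear C m -> Ct m} := piT qC m.
pose P' m : {linear Ct m -> C m} := piT qC m.
pose PP m : {linear C m -> C m} := piT qC m \o piT qC m.
have Pb m (x : C m.+1) : P m (pc_b C m x) = pc_b Ct m (P m.+1 x) by exact: (piTb qC x).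
have PB m (x : C m) : P m.+1 (pc_B C m x) = pc_B Ct m (P m x).
  by rewrite [RHS](Btilde_piT qC x).
have P'b m (x : Ct m.+1) : P' m (pc_b Ct m x) = pc_b C m (P' m.+1 x).
  exact: (piTb qC x).
have P'B m (x : Ct m) : P' m.+1 (pc_B Ct m x) = pc_B C m (P' m x).
  by rewrite [LHS](piT_Btilde qC x) [LHS](piTB qC x).
have mixed : is_mixed Ct by move=> m x; exact: (twist_Btilde qC x).
pose H m : {linear Ct m -> Ct m.+1} := contracting_homotopy qC m.
have HT m (x : Ct m) : H m (pc_T Ct m x) = pc_T Ct m.+1 (H m x).
  by rewrite !mixed.
have BH m (x : Ct m) : pc_B Ct m.+1 (H m x) = 0.
  exact: (Btilde_phi qC x).
have HB m (x : Ct m) : H m.+1 (pc_B Ct m x) = 0.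
  exact: (phi_Btilde qC x).
pose PPt m : {linear Ct m -> Ct m} := PP m.
have bH m (x : Ct m) : PPt m x - x =
    pc_b Ct m (H m x) + comp_down H (pc_b Ct) m x by exact: (phi_homotopy qC x).
split=> //; split.
- exact: (natural_map_Smap Pb PB).
- exact: (natural_map_Smap P'b P'B).
- exact: (natural_homotopic_to_id (h := PP) (phi_T qC) (B_phi qC) (phi_B qC)
    (phi_homotopy qC)).
- exact: (natural_homotopic_to_id (h := PPt) HT BH HB bH).
- exact: (sharp_map_Tmap Pb PB).
- exact: (sharp_map_Tmap P'b P'B).
- exact: (sharp_homotopic_to_id (h := PP) (phi_T qC) (B_phi qC) (phi_B qC)
    (phi_homotopy qC)).
- exact: (sharp_homotopic_to_id (h := PPt) HT BH HB bH).
Qed.
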